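(* For every integer $k\ge 0$, $|\mathcal{U}_{2k+1}(312,1432)|=\frac{1}{2k+1}\binom{3k}{k}$.
   Context: West's stack-sorting map $s$ is defined recursively on finite sequences of distinct positive integers: $s$ sends the empty sequence to itself, and if $\pi$ is a nonempty such sequence with largest entry $n$, writing $\pi=LnR$ one sets $s(\pi)=s(L)s(R)n$. A permutation $\pi\in S_n$ (one-line notation) is uniquely sorted if exactly one permutation $\sigma\in S_n$ satisfies $s(\sigma)=\pi$. Let $\mathcal{U}_n$ be the set of uniquely sorted permutations in $S_n$. A permutation $\pi$ contains a pattern $\tau\in S_m$ if some subsequence of $\pi$ of length $m$ has its entries in the same relative order as $\tau$; otherwise $\pi$ avoids $\tau$. $\mathcal{U}_{n}(\tau^{(1)},\dots,\tau^{(\ell)})$ denotes the set of permutations in $\mathcal{U}_n$ avoiding all of $\tau^{(1)},\dots,\tau^{(\ell)}$. *)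

(* Defs.v *)
From mathcomp Require Import all_boot all_order all_fingroup all_algebra.
From mathcomp Require Import zify.

Set Implicit Arguments.
Unset Strict Implicit.
Unset Printing Implicit Defensive.

Local Open Scope nat_scope.

(* [fuel] only makes the recursion structural; [stack_sort_cat] below is the
   defining recursion s(L n R) = s(L) s(R) n. *)
Fixpoint stack_sort_rec (fuel : nat) (w : seq nat) : seq nat :=
  if fuel isn't fuel'.+1 then [::] else
  if w is [::] then [::] else
  let n := \max_(x <- w) x in
  let L := take (index n w) w in
  let R := drop (index n w).+1 w in
  rcons (stack_sort_rec fuel' L ++ stack_sort_rec fuel' R) n.

Definition stack_sort (w : seq nat) : seq nat := stack_sort_rec (size w) w.

Lemma max_cat_lt (L R : seq nat) (n : nat) :
  all (fun x => x < n) (L ++ R) -> \max_(x <- L ++ n :: R) x = n.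
Proof.
rewrite all_cat => /andP[/allP hL /allP hR]; apply/eqP.
rewrite eqn_leq; apply/andP; split; last first.
  by apply: (@leq_bigmax_seq _ _ xpredT id); rewrite // mem_cat inE eqxx orbT.
apply/bigmax_leqP_seq => x; rewrite mem_cat inE => /or3P[/hL|/eqP->|/hR] //.
- by move/ltnW.
- by move/ltnW.
Qed.

Lemma index_cat_lt (L R : seq nat) (n : nat) :
  all (fun x => x < n) (L ++ R) -> index n (L ++ n :: R) = size L.
Proof.
rewrite all_cat => /andP[/allP hL _].
rewrite index_cat /= eqxx addn0 ifN //.
by apply/negP => /hL; rewrite ltnn.
Qed.

Lemma stack_sort_rec_fuel (f g : nat) (w : seq nat) :
  size w <= f -> size w <= g -> stack_sort_rec f w = stack_sort_rec g w.
Proof.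
elim: f g w => [|f IH] [|g] [|x w] //= hf hg.
set n := \max_(y <- _) y; set i := if _ then _ else _.
have hL h : size w < h.+1 -> i <= size w -> size (take i (x :: w)) <= h.
  by move=> hw hi; rewrite size_take /=; case: ltnP => hs; lia.
have hi : i <= size w.
  have : n \in x :: w.
    rewrite /n; elim: (w) (x) => [|z v IHv] y; first by rewrite big_seq1 inE.
    rewrite big_cons; have := IHv z.
    by case: (leqP (\max_(j <- z :: v) j) y) => _ h; rewrite in_cons ?eqxx ?h ?orbT.
  by rewrite -index_mem /= -/i ltnS.
have hR h : size w < h.+1 -> size (drop i w) <= h.
  by move=> hw; rewrite size_drop; lia.
by rewrite (IH g) ?(IH g _ (hR _ _)) ?hL ?hR.
Qed.

Lemma stack_sort_nil : stack_sort [::] = [::].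
Proof. by []. Qed.

Lemma stack_sort_cat (L R : seq nat) (n : nat) :
  all (fun x => x < n) (L ++ R) ->
  stack_sort (L ++ n :: R) = rcons (stack_sort L ++ stack_sort R) n.
Proof.
move=> h; rewrite {1}/stack_sort size_cat /= addnS /=.
case E: (L ++ n :: R) => [|x w]; first by case: (L) E.
rewrite -E max_cat_lt // index_cat_lt // take_size_cat //.
rewrite drop_cat ltnNge leqnSn /= subSnn /= drop0.
by congr (rcons (_ ++ _) _); apply: stack_sort_rec_fuel;
  rewrite ?leq_addr ?leq_addl.
Qed.

Definition one_line (n : nat) (p : 'S_n) : seq nat :=
  [seq (val (p i)).+1 | i <- enum 'I_n].

Definition uniquely_sorted (n : nat) (p : 'S_n) : bool :=
  #|[set q : 'S_n | stack_sort (one_line q) == one_line p]| == 1.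

Definition same_relative_order (u v : seq nat) : bool :=
  (size u == size v) &&
  [forall i : 'I_(size u), forall j : 'I_(size u),
    (nth 0 u i < nth 0 u j) == (nth 0 v i < nth 0 v j)].

Definition contains_pattern (w t : seq nat) : bool :=
  [exists m : (size w).-tuple bool, same_relative_order (mask m w) t].

Definition avoids (n : nat) (p : 'S_n) (t : seq nat) : bool :=
  ~~ contains_pattern (one_line p) t.

Definition uniquely_sorted_avoiding (n : nat) (ts : seq (seq nat)) : {set 'S_n} :=
  [set p : 'S_n | uniquely_sorted p && all (avoids p) ts].

(* Main.v *)
(* A preimage of w under s is a decreasing binary tree with postorder reading w.
   A node with a single child can be flipped, and when the root of the left
   subtree is smaller than the first leaf of the right subtree, the left subtree
   can be grafted onto that leaf; so if w has a unique preimage, every internal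
   node has two children and every leaf but the first is a descent of w. The word
   of descents and ascents of w is then a Dyck word, and it determines the tree.
   Conversely, in a 312-avoiding permutation every ascent is a left-to-right
   maximum, so each Dyck pattern is realised by a decreasing tree.

   A 312-avoiding permutation is the output of a stack fed with 1, 2, ..., n.
   Avoiding 1432 as well means that after each pop the stack retains at most one
   entry exceeding the first output. Such permutations with a Dyck pattern are
   Dyck words in which every run of r ascents between two descents has weight
   r + 1; splitting each such run in two turns them into words with 2k letters E
   and k letters A in which every prefix satisfies 2 #A <= #E. *)
Require Import Defs.
From mathcomp Require Import all_boot all_order all_fingroup all_algebra.
From mathcomp Require Import zify ring lra.

Set Implicit Arguments.
Unset Strict Implicit.
Unset Printing Implicit Defensive.

Import Order.TTheory GRing.Theory Num.Theory.
Local Open Scope nat_scope.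

(** * Preimages under stack sorting *)

(** Only distinctness of [q] is required, so that the notion applies to the factors of a permutation
    met in the recursion. *)
Definition preimage (w q : seq nat) : bool := uniq q && (stack_sort q == w).

Lemma uniq_max_split (q : seq nat) :
  uniq q -> q != [::] ->
  exists L n R, q = L ++ n :: R /\ all (fun x => x < n) (L ++ R).
Proof.
move=> uq q0.
have : \max_(x <- q) x \in q.
  elim: q q0 {uq} => // x [|y q] IH _; first by rewrite big_seq1 inE.
  rewrite big_cons /maxn; case: ifP => _; last by rewrite inE eqxx.
  by rewrite inE IH ?orbT.
have : {in q, forall y, y <= \max_(x <- q) x}.
  by move=> y yq; apply: (@leq_bigmax_seq _ _ xpredT id).
move: (\max_(x <- q) x) => n leqn /splitPr E; case: E uq leqn => L R uq leqn.
exists L, n, R; split=> //; apply/allP => y yLR.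
have := leqn y; rewrite mem_cat inE orbCA -mem_cat yLR orbT => /(_ isT).
rewrite leq_eqVlt => /predU1P[yn|//].
by move: uq; rewrite (uniq_catCA L [:: n] R) /= -yn yLR.
Qed.

Lemma stack_sort_perm (q : seq nat) : uniq q -> perm_eq (stack_sort q) q.
Proof.
have [k] := ubnP (size q); elim: k q => // k IH q qk uq.
have [->|q0] := eqVneq q [::]; first by [].
have [L [n [R [qE LRn]]]] := uniq_max_split uq q0.
move: uq qk; rewrite {}qE stack_sort_cat // => uq; rewrite size_cat /= => qk.
have /and3P[uL _ uR] : [&& uniq L, true & uniq R].
  by move: uq; rewrite cat_uniq /= => /and3P[-> _ /andP[_ ->]].
have /seq.permP pL := IH L ltac:(lia) uL; have /seq.permP pR := IH R ltac:(lia) uR.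
by apply/seq.permP => a; rewrite -cats1 !count_cat pL pR /=; lia.
Qed.

Lemma preimage_perm w q : preimage w q -> perm_eq w q.
Proof. by move=> /andP[uq /eqP <-]; apply: stack_sort_perm. Qed.

Lemma preimage_nil q : preimage [::] q -> q = [::].
Proof. by move/preimage_perm/perm_size/esym/size0nil. Qed.

Lemma preimage_rcons_inv w n q :
  preimage (rcons w n) q ->
  exists a b L R, [/\ q = L ++ n :: R, w = a ++ b, preimage a L, preimage b R &
    all (fun x => x < n) w].
Proof.
move=> pq; have /andP[uq /eqP sq] := pq.
have q0 : q != [::] by apply/eqP => q0; rewrite q0 in sq; case: (w) sq.
have [L [m [R [qE LRm]]]] := uniq_max_split uq q0.
move: sq; rewrite qE stack_sort_cat // => /rcons_inj[wE mn].
have /andP[uL uR] : uniq L && uniq R.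
  by move: uq; rewrite qE cat_uniq /= => /and3P[-> _ /andP[_ ->]].
exists (stack_sort L), (stack_sort R), L, R.
split; rewrite /preimage ?uL ?uR ?eqxx ?qE ?mn // -wE -mn.
by rewrite all_cat !(perm_all _ (stack_sort_perm _)) // -all_cat.
Qed.

Lemma preimage_rcons a b n L R :
  preimage a L -> preimage b R -> all (fun x => x < n) (a ++ b) ->
  uniq (a ++ b) -> preimage (rcons (a ++ b) n) (L ++ n :: R).
Proof.
move=> pL pR abn uab.
have pab : perm_eq (a ++ b) (L ++ R).
  by apply: perm_cat; apply: preimage_perm.
have LRn : all (fun x => x < n) (L ++ R) by rewrite -(perm_all _ pab).
apply/andP; split.
  rewrite (uniq_catCA L [:: n] R) /= -(perm_uniq pab) uab andbT.
  by apply/negP => /(allP LRn); rewrite ltnn.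
case/andP: pL => _ /eqP <-; case/andP: pR => _ /eqP <-.
by rewrite stack_sort_cat.
Qed.

Lemma preimage_last w n q : preimage (rcons w n) q -> all (fun x => x < n) w.
Proof. by move=> /preimage_rcons_inv[? [? [? [? []]]]]. Qed.

Lemma preimage_uniq w q : preimage w q -> uniq w.
Proof. by move=> pq; rewrite (perm_uniq (preimage_perm pq)); case/andP: pq. Qed.

(** * Descent words and Dyck words *)

Definition descent_word (w : seq nat) : seq bool :=
  if w is x :: s then pairmap (fun a b => b < a) x s else [::].

Lemma descent_word_cat x s y v :
  descent_word ((x :: s) ++ (y :: v)) =
    descent_word (x :: s) ++ (y < last x s) :: descent_word (y :: v).
Proof. by rewrite /= pairmap_cat. Qed.

(** Lattice paths from height [e] to 0 that stay nonnegative, with descents as up steps; [e = 0]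
    gives the Dyck words. *)
Fixpoint balanced_from (e : nat) (u : seq bool) : bool :=
  match u with
  | [::] => e == 0
  | true :: u' => balanced_from e.+1 u'
  | false :: u' => if e is e'.+1 then balanced_from e' u' else false
  end.

Lemma balanced_cat e f u v :
  balanced_from e u -> balanced_from f v -> balanced_from (e + f) (u ++ v).
Proof.
elim: u e => [|[] u IH] e /=; first by move/eqP->.
  by move=> hu hv; rewrite -addSn IH.
by case: e => // e hu hv; rewrite addSn IH.
Qed.

Lemma balanced_node u v :
  balanced_from 0 u -> balanced_from 0 v ->
  balanced_from 0 (u ++ true :: rcons v false).
Proof.
move=> hu hv; have := @balanced_cat 0 0 u (true :: rcons v false) hu; apply.
by have := @balanced_cat 0 1 v [:: false] hv isT; rewrite cats1.
Qed.

Lemma balanced_count e u :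
  balanced_from e u -> e + count id u = count negb u.
Proof.
elim: u e => [|[] u IH] [|e] //=; first by move/IH=> /=; lia.
  by move/IH=> /=; lia.
by move/IH=> /=; lia.
Qed.

Lemma balanced_prefix e u v :
  balanced_from e (u ++ v) -> count negb u <= e + count id u.
Proof.
elim: u e => [|[] u IH] [|e] //=; first by move/IH=> /=; lia.
  by move/IH=> /=; lia.
by move/IH=> /=; lia.
Qed.

Lemma descent_word_rcons a b n :
  all (fun x => x < n) (a ++ b) -> a ++ b != [::] ->
  descent_word (rcons (a ++ b) n) = rcons (descent_word (a ++ b)) false.
Proof.
case: (a ++ b) => //= x s /andP[xn sn] _.
rewrite -!cats1 pairmap_cat /=; congr (_ ++ [:: _]).
have /allP/(_ (last x s) (mem_last _ _)) : all (fun x => x < n) (x :: s) by rewrite /= xn.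
by move=> ?; apply/negbTE; rewrite -leqNgt ltnW.
Qed.

(* A node of the decreasing binary tree with postorder reading [w] contributes
   a descent only if it has two children; equality forces every internal node
   to be binary. *)
Lemma preimage_descents w q :
  preimage w q ->
  (count id (descent_word w) <= count negb (descent_word w)) /\
  (count id (descent_word w) = count negb (descent_word w) -> balanced_from 0 (descent_word w)).
Proof.
have [k] := ubnP (size w); elim: k w q => // k IH w q.
case/lastP: w => [//|w n]; rewrite size_rcons => wk pq.
have [a [b [L [R [qE wE pa pb wn]]]]] := preimage_rcons_inv pq.
move: wn wk; rewrite wE size_cat => wn wk.
have [ha ba] := IH a L ltac:(lia) pa; have [hb bb] := IH b R ltac:(lia) pb.
case: a b {pa pb wE} ha hb ba bb wn wk => [|x a] [|y b] // ha hb ba bb wn wk.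
- rewrite descent_word_rcons // -cats1 !count_cat /=; rewrite /= in hb; split=> [|E]; lia.
- rewrite descent_word_rcons // -cats1 cats0 !count_cat /=; rewrite /= in ha; split=> [|E]; lia.
rewrite descent_word_rcons // descent_word_cat -cats1 -catA !count_cat /=.
set d := _ < _; split; first by rewrite /= in ha hb; case: d; lia.
case: d => E; last by rewrite /= in ha hb E; lia.
rewrite cats1; apply: balanced_node; [apply: ba | apply: bb]; rewrite /= in ha hb E *; lia.
Qed.

(** Equal numbers of descents and ascents leave no slack in the inequalities of [preimage_descents]:
    neither half can be empty, equality holds in both, and the letter between them is a descent. *)
Lemma balanced_split a b n L R :
  preimage a L -> preimage b R -> all (fun x => x < n) (a ++ b) ->
  a ++ b != [::] -> balanced_from 0 (descent_word (rcons (a ++ b) n)) ->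
  [/\ a != [::], b != [::], balanced_from 0 (descent_word a), balanced_from 0 (descent_word b) &
      descent_word (a ++ b) = descent_word a ++ true :: descent_word b].
Proof.
move=> pa pb wn ab0; rewrite descent_word_rcons // => /balanced_count.
have [ha ba] := preimage_descents pa; have [hb bb] := preimage_descents pb.
case: a b {pa pb ab0} ha hb ba bb wn => [|x a] [|y b] // ha hb ba bb wn;
  rewrite -cats1 ?cats0 !count_cat.
- by rewrite /= in hb * => E; exfalso; lia.
- by rewrite /= in ha * => E; exfalso; lia.
rewrite !descent_word_cat !count_cat; set d := _ < _; rewrite /= in ha hb ba bb *.
case: d => /= E; last by exfalso; lia.
by split=> //; [apply: ba | apply: bb]; lia.
Qed.

(* Two different parses of a Dyck word [u D v A] would give a prefix of [v]
   with more ascents than descents. *)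
Lemma balanced_split_uniq a b a' b' n L R L' R' :
  preimage a L -> preimage b R -> preimage a' L' -> preimage b' R' ->
  all (fun x => x < n) (a ++ b) -> a ++ b != [::] ->
  balanced_from 0 (descent_word (rcons (a ++ b) n)) ->
  a ++ b = a' ++ b' -> size a <= size a' -> a = a'.
Proof.
move=> pa pb pa' pb' wn ab0 bal E szaa.
have [a0 b0 ba bb dab] := balanced_split pa pb wn ab0 bal.
rewrite E in wn ab0 bal.
have [a0' b0' ba' bb' dab'] := balanced_split pa' pb' wn ab0 bal.
have Ea : a = take (size a) a'.
  by have := congr1 (take (size a)) E; rewrite take_size_cat // takel_cat.
have := cat_take_drop (size a) a'; rewrite -Ea => Ea'.
move: (drop _ _) Ea' => c Ea'; rewrite -Ea' -catA in E.
have Eb : b = c ++ b' by apply/eqP; move/eqP: E; rewrite eqseq_cat // eqxx.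
case: c => [|z c] in Ea' Eb {E} *; first by rewrite cats0 in Ea'.
case: a => [|x a] // in a0 ba Ea Ea' dab szaa pa *.
case: b' => [|y b'] // in b0' bb' dab' Eb pb' wn ab0 bal *.
move: dab bb; rewrite Eb !descent_word_cat => /eqP; rewrite eqseq_cat // => /andP[_ /eqP [zx]].
move=> /balanced_prefix.
move: ba'; rewrite -Ea' !descent_word_cat zx => /balanced_count.
have := balanced_count ba; rewrite !count_cat /=; lia.
Qed.

Lemma cat_cons_inj (L L' R R' : seq nat) n :
  size L = size L' -> L ++ n :: R = L' ++ n :: R' -> L = L' /\ R = R'.
Proof.
by move=> sz /eqP; rewrite eqseq_cat // => /andP[/eqP -> /eqP[->]].
Qed.

(** [balanced_split_uniq] forces the place where the root cuts the word, and both halves are again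
    balanced, so the tree is determined recursively. *)
Lemma balanced_preimage_uniq w q q' :
  preimage w q -> preimage w q' -> balanced_from 0 (descent_word w) -> q = q'.
Proof.
have [k] := ubnP (size w); elim: k w q q' => // k IH w q q'.
case/lastP: w => [_ /preimage_nil-> /preimage_nil-> //|w n].
rewrite size_rcons => wk pq pq' bal.
have [a [b [L [R [-> wE pa pb wn]]]]] := preimage_rcons_inv pq.
have [a' [b' [L' [R' [-> wE' pa' pb' _]]]]] := preimage_rcons_inv pq'.
have E : a ++ b = a' ++ b' by rewrite -wE.
have [w0|w0] := eqVneq w [::].
  have nilcat (u v : seq nat) : [::] = u ++ v -> u = [::] /\ v = [::] by case: u.
  rewrite w0 in wE wE'; move: pa pb pa' pb'.
  have [-> ->] := nilcat _ _ wE; have [-> ->] := nilcat _ _ wE'.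
  by do 4!move/preimage_nil->.
have Eaa : a = a'.
  rewrite wE in w0 wn bal.
  case: (leqP (size a) (size a')) => [|/ltnW] sz.
    exact: (balanced_split_uniq pa pb pa' pb' wn w0 bal E).
  rewrite E in wn w0 bal.
  by rewrite (balanced_split_uniq pa' pb' pa pb wn w0 bal (esym E)).
have Ebb : b = b' by move/eqP: E; rewrite Eaa eqseq_cat // eqxx => /eqP.
rewrite wE in w0 wn bal; move: wk; rewrite wE size_cat => wk.
have [_ _ ba bb _] := balanced_split pa pb wn w0 bal.
rewrite -Eaa in pa'; rewrite -Ebb in pb'.
by rewrite (IH a L L' _ pa pa' ba) ?(IH b R R' _ pb pb' bb) //; lia.
Qed.

(* The tree of [a] can be grafted onto the first leaf of the tree of [b]. *)
Lemma preimage_graft a b L R :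
  preimage a L -> preimage b R -> a != [::] -> b != [::] -> uniq (a ++ b) ->
  last 0 a < head 0 b -> exists q, preimage (a ++ b) q.
Proof.
have [k] := ubnP (size b); elim: k b R => // k IH b R.
case/lastP: b => [//|b n]; rewrite size_rcons => bk pa pb a0 _ uab lah.
have [b1 [b2 [R1 [R2 [_ bE p1 p2 bn]]]]] := preimage_rcons_inv pb.
(* The last entry of a sortable word is its maximum; that of [a] is below the head of [b], hence
   below the root [n]. *)
have an : all (fun x => x < n) a.
  have hn : head 0 (rcons b n) <= n by case: b bn {bE pb lah uab bk} => //= x b /andP[/ltnW].
  have [a' [x aE]] : exists a' x, a = rcons a' x.
    by case/lastP: (a) a0 => // a' x; exists a', x.
  move: lah pa; rewrite aE last_rcons => xh pa.
  have xn := leq_trans xh hn.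
  rewrite all_rcons xn; apply: sub_all (preimage_last pa) => y; lia.
have abn : all (fun x => x < n) (a ++ b) by rewrite all_cat an.
have uab' : uniq (a ++ b).
  by move: uab; rewrite -rcons_cat rcons_uniq => /andP[].
rewrite bE in abn uab' lah bk *; rewrite size_cat in bk.
(* The first leaf lies in the left subtree if there is one, otherwise in the right one; if both are
   empty it is [n] itself, and the tree of [a] becomes its left child. *)
case: b1 => [|x b1] in p1 abn uab' lah bk {pb bn uab bE} *; last first.
  have [|q pq] := IH (x :: b1) R1 ltac:(lia) pa p1 a0 isT _ lah.
    by move: uab'; rewrite catA cat_uniq => /andP[].
  by exists (q ++ n :: R2); rewrite -rcons_cat catA; apply: preimage_rcons; rewrite // -catA.
case: b2 => [|x b2] in p2 abn uab' lah bk *.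
  exists (L ++ n :: [::]); rewrite -rcons_cat; apply: preimage_rcons => //.
have [|q pq] := IH (x :: b2) R2 ltac:(lia) pa p2 a0 isT _ lah; first by [].
exists (q ++ n :: [::]); rewrite -rcons_cat /= -(cats0 (a ++ _)).
by apply: preimage_rcons; rewrite // cats0.
Qed.

Lemma preimage_unary_flip w n q :
  w != [::] -> all (fun x => x < n) w -> preimage w q ->
  exists q1 q2, [/\ preimage (rcons w n) q1, preimage (rcons w n) q2 & q1 <> q2].
Proof.
move=> w0 wn pq; have uw := preimage_uniq pq.
have pn : preimage [::] [::] by [].
exists (n :: q), (q ++ [:: n]); split.
- exact: (preimage_rcons (a := [::]) pn pq wn uw).
- by rewrite -(cats0 w); apply: preimage_rcons; rewrite ?cats0.
have pwq := preimage_perm pq.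
have qn : all (fun x => x < n) q by rewrite -(perm_all _ pwq).
case: q {pq} pwq qn => [/perm_nilP w00|x q _ /=]; first by rewrite w00 in w0.
by case/andP => xn _ [nx _]; rewrite nx ltnn in xn.
Qed.

(** Changing the preimage of one half changes the preimage of the whole, so uniqueness passes to
    both halves. Excluding flips and grafts leaves two nonempty halves separated by a descent, which
    is the shape of [balanced_node]. *)
Lemma unique_preimage_balanced w q :
  preimage w q -> (forall q', preimage w q' -> q' = q) ->
  balanced_from 0 (descent_word w).
Proof.
have [k] := ubnP (size w); elim: k w q => // k IH w q.
case/lastP: w => [//|w n]; rewrite size_rcons => wk pq uq.
have [->|w0] := eqVneq w [::]; first by [].
have [a [b [L [R [qE wE pa pb wn]]]]] := preimage_rcons_inv pq.
(* A preimage of [w] could serve as the only child of [n], on either side. *)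
have noflip q1 : preimage w q1 -> False.
  move=> p1; have [q2 [q3 [p2 p3]]] := preimage_unary_flip w0 wn p1.
  by rewrite (uq _ p2) (uq _ p3).
have uw := preimage_uniq pq; rewrite rcons_uniq in uw; case/andP: uw => _ uw.
have a0 : a != [::].
  by apply/eqP => a0; apply: (noflip R); rewrite wE a0.
have b0 : b != [::].
  by apply/eqP => b0; apply: (noflip L); rewrite wE b0 cats0.
move: (wk) (uw) (wn) (w0); rewrite wE size_cat => abk uab abn ab0.
have ba : balanced_from 0 (descent_word a).
  apply: (IH a L _ pa); first by lia.
  move=> L' pL'; have := preimage_rcons pL' pb abn uab; rewrite -wE => /uq.
  rewrite qE => /cat_cons_inj[] //.
  by rewrite -(perm_size (preimage_perm pL')) (perm_size (preimage_perm pa)).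
have bb : balanced_from 0 (descent_word b).
  apply: (IH b R _ pb); first by lia.
  by move=> R' pR'; have := preimage_rcons pa pR' abn uab; rewrite -wE => /uq;
     rewrite qE => /cat_cons_inj[].
rewrite descent_word_rcons //.
case: a b => [|x a] [|y b] // in pa pb wE a0 b0 ba bb abn uab ab0 {wk uw wn w0 abk} *.
rewrite descent_word_cat; case: ltnP => /= xy; last first.
  have lxy : last 0 (x :: a) < head 0 (y :: b).
    rewrite /= ltn_neqAle xy andbT; apply/eqP => E.
    move: uab; rewrite cat_uniq => /and3P[_ /hasPn/(_ y (mem_head _ _)) + _].
    by rewrite /= -E mem_last.
  (* The grafted tree reads [w] in full, so [n] could be placed above it as a node with one
     child. *)
  have [q1] := preimage_graft pa pb a0 b0 uab lxy.
  by rewrite -wE => /noflip.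
rewrite -cats1 -catA /= cats1; exact: balanced_node.
Qed.

(** * Pop sequences of a stack *)

(* Letter [c] stands for [c] pushes followed by one pop.
   [h]: whether an entry larger than the first one is left in the stack;
   [e]: number of descents minus number of ascents. *)
Definition step (c : nat) (he : bool * nat) : option (bool * nat) :=
  let: (h, e) := he in
  match c with
  | 0 => Some (false, e.+1)
  | 1 => if e is e'.+1 then Some (h, e') else None
  | 2 => if e is e'.+1 then if h then None else Some (true, e') else None
  | _ => None
  end.

Fixpoint run (he : bool * nat) (t : seq nat) : option (bool * nat) :=
  if t is c :: t' then obind (run^~ t') (step c he) else Some he.

(* [st] is the stack and [p] the last entry pushed. *)
Fixpoint pops (st : seq nat) (p : nat) (t : seq nat) : seq nat :=
  match t with
  | [::] => [::]
  | 0 :: t' => head 0 st :: pops (behead st) p t'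
  | 1 :: t' => p.+1 :: pops st p.+1 t'
  | _ :: t' => p.+2 :: pops (p.+1 :: st) p.+2 t'
  end.

(** A letter 0 removes the large entry when [h] holds and an entry below the first output otherwise;
    only the latter are counted. An accepted [t] thus exactly empties a stack of size
    [small_pops h t + h]. *)
Fixpoint small_pops (h : bool) (t : seq nat) : nat :=
  match t with
  | [::] => 0
  | 0 :: t' => ~~ h + small_pops false t'
  | 1 :: t' => small_pops h t'
  | _ :: t' => small_pops true t'
  end.

(** Induction along accepting runs, so that later proofs never meet a rejected letter. *)
Lemma run_ind (P : bool -> nat -> seq nat -> Prop) :
  P false 0 [::] ->
  (forall h e t, run (false, e.+1) t = Some (false, 0) ->
    P false e.+1 t -> P h e (0 :: t)) ->
  (forall h e t, run (h, e) t = Some (false, 0) ->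
    P h e t -> P h e.+1 (1 :: t)) ->
  (forall e t, run (true, e) t = Some (false, 0) ->
    P true e t -> P false e.+1 (2 :: t)) ->
  forall t h e, run (h, e) t = Some (false, 0) -> P h e t.
Proof.
move=> P0 Pd P1 P2; elim=> [|[|[|[|c]]] t IH] h e //=.
- by case=> -> ->.
- by move=> rt; apply: Pd (IH _ _ rt).
- by case: e => //= e rt; apply: P1 (IH _ _ rt).
- by case: e h => //= e [] //= rt; apply: P2 (IH _ _ rt).
Qed.

(** [sumn t] is the number of pushes. The hypothesis on the size of [st] makes the stack end empty
    and keeps [head 0] from ever using its default value. *)
Lemma perm_pops t h e st p :
  run (h, e) t = Some (false, 0) -> size st = small_pops h t + h ->
  perm_eq (pops st p t) (st ++ iota p.+1 (sumn t)).
Proof.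
move=> rt; elim/run_ind: h e t / rt st p => [|h e t _ IH|h e t _ IH|e t _ IH] st p /=.
- by rewrite addn0 => /size0nil->.
- case: st => [|y st] /= sz; first by case: h sz; rewrite /=; lia.
  by rewrite perm_cons IH //; case: h sz; rewrite /=; lia.
- move=> /(IH st p.+1)/seq.permP pt; apply/seq.permP => a.
  by rewrite add0n /= pt !count_cat /=; lia.
move=> sz; have /(IH (p.+1 :: st) p.+2)/seq.permP pt : (size (p.+1 :: st) =
  small_pops true t + true)%N by rewrite /=; lia.
by apply/seq.permP => a; rewrite add0n /= pt /= !count_cat /=; lia.
Qed.

Lemma subseq_pops t h e st p :
  run (h, e) t = Some (false, 0) -> size st = small_pops h t + h ->
  subseq st (pops st p t).
Proof.
move=> rt; elim/run_ind: h e t / rt st p => [|h e t _ IH|h e t _ IH|e t _ IH] st p sz.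
- by move: sz => /= /size0nil->.
- case: st sz => [|y st] /= sz; first by case: h sz; rewrite /=; lia.
  by rewrite eqxx IH //; case: h sz; rewrite /=; lia.
- by apply: subseq_trans (subseq_cons _ _); apply: IH.
apply: subseq_trans (subseq_cons _ _).
apply: subseq_trans (IH (p.+1 :: st) p.+2 _); first exact: subseq_cons.
by move: sz => /=; lia.
Qed.

(** Here [x] is the last output. It exceeds the whole stack, so popping an old entry is a descent;
    it is at most [p], so popping a fresh entry is an ascent. *)
Lemma descent_word_pops t h e st p x :
  run (h, e) t = Some (false, 0) -> size st = small_pops h t + h ->
  sorted gtn (x :: st) -> x <= p ->
  balanced_from e (pairmap (fun a b => b < a) x (pops st p t)).
Proof.
move=> rt; elim/run_ind: h e t / rt st p x => [|h e t _ IH|h e t _ IH|e t _ IH] st p x sz xst xp.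
- by [].
- case: st sz xst => [|y st] /= sz; first by case: h sz; rewrite /=; lia.
  case/andP=> yx yst; rewrite yx; apply: IH => //; last by lia.
  by case: h sz; rewrite /=; lia.
- rewrite /= ltnNge ltnW ?ltnS //; apply: IH => //.
  case: st xst sz => //= y st /andP[yx ->] _; rewrite andbT; lia.
rewrite /= ltnNge ltnW /=; last lia.
apply: IH => //=; first by move: sz => /=; lia.
rewrite ltnSn /=; case: st xst sz => //= y st /andP[yx ->] _; rewrite andbT; lia.
Qed.

Lemma run_letters t h e :
  run (h, e) t = Some (false, 0) -> all (fun c => c <= 2) t.
Proof. by move=> rt; elim/run_ind: h e t / rt. Qed.

(** The first output reveals the first letter: it is at most [p] for 0, [p.+1] for 1 and [p.+2] for
    2. *)
Lemma pops_inj t t' st p :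
  all (fun c => c <= 2) t -> all (fun c => c <= 2) t' ->
  all (fun x => x <= p) st -> pops st p t = pops st p t' -> t = t'.
Proof.
elim: t t' st p => [|c t IH] [|c' t'] st p //=.
- by case: c' => [|[|]].
- by case: c => [|[|]].
move=> /andP[c2 t2] /andP[c2' t2'] stp.
have hd : head 0 st <= p by case: st stp => //= ? ? /andP[].
have tl : all (fun x => x <= p) (behead st) by case: st stp {hd} => //= ? ? /andP[].
have up : all (fun x => x <= p.+1) st by apply: sub_all stp => y; lia.
have up2 : all (fun x => x <= p.+2) st by apply: sub_all stp => y; lia.
case: c c' c2 c2' => [|[|[|c]]] [|[|[|c']]] // _ _ [] E; try by exfalso; lia.
- by rewrite (IH _ _ _ _ _ _ E).
- by rewrite (IH _ _ _ _ _ _ E).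
by rewrite (IH _ _ _ _ _ _ E) //= leqnSn.
Qed.

(** * Pattern avoidance in pop sequences *)

Lemma subseq_desc s st a b :
  uniq s -> subseq st s -> sorted gtn st -> a \in st -> b \in st ->
  subseq [:: a; b] s -> b < a.
Proof.
move=> us sts sst ast bst ab.
have : subseq [:: a; b] st.
  by rewrite (elimT (subseq_uniqP us) sts) subseq_filter /= ast bst.
move/subseq_sorted => /(_ gtn _ sst) /=; rewrite andbT; apply.
by move=> y x z /= yx zy; apply: ltn_trans zy yx.
Qed.

Definition avoids312 (s : seq nat) :=
  forall a b c, a < b -> b < c -> subseq [:: c; a; b] s -> False.

(** When [m] is the first entry, this excludes the occurrences of 1432 in which [m] plays the role
    of 1. *)
Definition avoids321_above (m : nat) (s : seq nat) :=
  forall b c d, m < b -> b < c -> c < d -> subseq [:: d; c; b] s -> False.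

Lemma subseq_cons2 (T : eqType) (x y : T) u v :
  subseq (x :: u) (y :: v) -> subseq (x :: u) v \/ x = y /\ subseq u v.
Proof. by rewrite /=; case: eqP => [->|_]; [right | left]. Qed.

(** A forbidden pattern starting at [x] uses two later entries below [x]. Both are in the stack, so
    they come out in decreasing order, which rules out 312; at most one exceeds [m], which rules out
    321 above [m]. *)
Lemma pop_avoids m st x s :
  (forall y, y \in s -> y < x -> y \in st) ->
  uniq s -> subseq st s -> sorted gtn st ->
  (forall b c, b \in st -> c \in st -> m < b -> m < c -> b = c) ->
  avoids312 s /\ avoids321_above m s ->
  avoids312 (x :: s) /\ avoids321_above m (x :: s).
Proof.
move=> below us sts sst big [a312 a321]; split.
  move=> a b c ab bc /subseq_cons2[|[cx sab]]; first exact: (a312 a b c).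
  have inst y : y \in [:: a; b] -> y < x -> y \in st by move/(mem_subseq sab); apply: below.
  have := subseq_desc us sts sst _ _ sab; rewrite !inst ?inE ?eqxx ?orbT //; last first;
    rewrite -?cx; lia.
move=> b c d mb bc cd /subseq_cons2[|[dx scb]]; first exact: (a321 b c d).
have inst y : y \in [:: c; b] -> y < x -> y \in st by move/(mem_subseq scb); apply: below.
have := big b c; rewrite !inst ?inE ?eqxx ?orbT //; rewrite -?dx; lia.
Qed.

Lemma uniq_pops t h e st p :
  run (h, e) t = Some (false, 0) -> size st = small_pops h t + h ->
  sorted gtn st -> all (fun x => x <= p) st -> uniq (pops st p t).
Proof.
move=> rt sz sst stp; rewrite (perm_uniq (perm_pops p rt sz)) cat_uniq iota_uniq andbT.
apply/andP; split.
  by apply: (sorted_uniq _ _ sst) => [y x z|x] /=; [lia | rewrite ltnn].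
by apply/hasPn => y; rewrite mem_iota => yp; apply/negP => /(allP stp); lia.
Qed.

(** The condition on [drop h st] says that every stack entry lies below [m], except possibly the top
    one when [h] holds. *)
Lemma pops_avoids m t h e st p :
  run (h, e) t = Some (false, 0) -> size st = small_pops h t + h ->
  sorted gtn st -> all (fun x => x <= p) st -> m <= p ->
  all (fun x => x < m) (drop h st) ->
  avoids312 (pops st p t) /\ avoids321_above m (pops st p t).
Proof.
move=> rt.
have one (h' : bool) st' : all (fun x => x < m) (drop h' st') ->
    forall b c, b \in st' -> c \in st' -> m < b -> m < c -> b = c.
  move=> /allP small.
  have {}small y : y \in st' -> m < y -> y = head 0 st'.
    case: h' small => [|/(_ y)]; last by rewrite drop0 => small /small; lia.
    case: st' => //= z st' /(_ y); rewrite drop0 inE => small.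
    by case/predU1P => // /small; lia.
  by move=> b c bst cst mb mc; rewrite (small b bst mb) (small c cst mc).
elim/run_ind: h e t / rt st p => [|h e t rt IH|h e t rt IH|e t rt IH] st p sz sst stp mp sm.
- by [].
- case: st sz sst stp sm => [|y st] sz sst stp sm; first by move: sz => /=; case: (h);
    rewrite /=; lia.
  have sz' : size st = small_pops false t + false by move: sz => /=; case: (h); rewrite /=; lia.
  have sst' := path_sorted sst.
  have /andP[yp stp'] := stp.
  have sm' : all (fun x => x < m) (drop false st).
    by rewrite drop0; case: (h) sm => /=; rewrite ?drop0 // => /andP[].
  apply: (@pop_avoids m st); last exact: IH.
  + by move=> z; rewrite (perm_mem (perm_pops p rt sz')) mem_cat mem_iota;
      case: (z \in st) => //=; lia.
  + exact: uniq_pops rt _ _ _.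
  + exact: subseq_pops rt _.
  + by [].
  + exact: one sm'.
- have stp' : all (fun x => x <= p.+1) st by apply: sub_all stp => y; lia.
  apply: (@pop_avoids m st); last by apply: IH => //; lia.
  + by move=> z; rewrite (perm_mem (perm_pops p.+1 rt sz)) mem_cat mem_iota;
      case: (z \in st) => //=; lia.
  + exact: uniq_pops rt _ _ _.
  + exact: subseq_pops rt _.
  + by [].
  + exact: one sm.
have stp' : all (fun x => x <= p.+2) (p.+1 :: st).
  by rewrite /= leqnSn; apply: sub_all stp => y; lia.
have sz' : size (p.+1 :: st) = small_pops true t + true by move: sz => /=; lia.
have sst' : sorted gtn (p.+1 :: st).
  by case: st sst stp {sz sz' stp' sm} => //= y st -> /andP[yp _]; rewrite andbT; lia.
have sm' : all (fun x => x < m) (drop true (p.+1 :: st)) by move: sm; rewrite /= !drop0.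
apply: (@pop_avoids m (p.+1 :: st)); last by apply: IH => //; lia.
+ by move=> z; rewrite (perm_mem (perm_pops p.+2 rt sz')) mem_cat mem_iota;
    case: (z \in _) => //=; lia.
+ exact: uniq_pops rt _ _ _.
+ exact: subseq_pops rt _.
+ by [].
+ exact: one sm'.
Qed.

(** * Sortability of pop sequences *)

Definition sortable (w : seq nat) := exists q, preimage w q.

Lemma sortable_rcons a b n :
  sortable a -> sortable b -> all (fun x => x < n) (a ++ b) -> uniq (a ++ b) ->
  sortable (rcons (a ++ b) n).
Proof.
by move=> [L pL] [R pR] abn uab; exists (L ++ n :: R); apply: preimage_rcons.
Qed.

(* [P] is the list, last block first, of the sortable blocks forming the prefix
   already read; an ascent is a left-to-right maximum, so it merges two blocks. *)
Lemma pops_sortable t h e st p P :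
  run (h, e) t = Some (false, 0) -> size P = e.+1 ->
  (forall w, w \in P -> sortable w) ->
  all (fun x => x <= p) (flatten P) -> all (fun x => x <= p) st ->
  uniq (flatten (rev P) ++ pops st p t) ->
  sortable (flatten (rev P) ++ pops st p t).
Proof.
have le_trans p' q s : p' <= q -> all (fun x => x <= p') s -> all (fun x => x <= q) s.
  by move=> pq; apply: sub_all => y yp; apply: leq_trans yp pq.
(* A new left-to-right maximum [x] becomes the root above the last two blocks. *)
have merge x s a b P' p' : p' < x ->
    (forall w, w \in b :: a :: P' -> sortable w) ->
    all (fun y => y <= p') (flatten (b :: a :: P')) ->
    uniq (flatten (rev (b :: a :: P')) ++ x :: s) ->
    [/\ flatten (rev (b :: a :: P')) ++ x :: s =
          flatten (rev (rcons (a ++ b) x :: P')) ++ s,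
        forall w, w \in rcons (a ++ b) x :: P' -> sortable w &
        all (fun y => y <= x) (flatten (rcons (a ++ b) x :: P'))].
  move=> px sP Pp us.
  have fE : flatten (rev (b :: a :: P')) = flatten (rev P') ++ a ++ b.
    by rewrite !rev_cons !flatten_rcons -catA.
  have [/= Pb Pa PP] : [/\ all (fun y => y <= p') b, all (fun y => y <= p') a &
      all (fun y => y <= p') (flatten P')].
    by move: Pp; rewrite /= !all_cat => /and3P[].
  have abx : all (fun y => y < x) (a ++ b).
    by rewrite all_cat; apply/andP; split; [move: Pa | move: Pb];
       apply: sub_all => y yp; apply: leq_ltn_trans yp px.
  split.
  - by rewrite fE rev_cons flatten_rcons -cats1 -!catA.
  - move=> w; rewrite inE => /predU1P[->|wP]; last by apply: sP; rewrite !inE wP !orbT.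
    apply: sortable_rcons => //; try by apply: sP; rewrite !inE eqxx ?orbT.
    by move: us; rewrite fE -catA cat_uniq -catA => /and3P[_ _]; rewrite catA cat_uniq =>
      /and3P[].
  by rewrite /= all_cat all_rcons leqnn (sub_all _ abx) ?(le_trans p' x) //= 1?ltnW // => y /ltnW.
move=> rt; elim/run_ind: h e t / rt st p P =>
  [|h e t rt IH|h e t rt IH|e t rt IH] st p P szP sP Pp stp us.
- case: P szP sP {Pp us} => [|a [|//]] // _ sP.
  by rewrite /= !cats0; apply: sP; rewrite inE.
(* A descent opens a new block with a single entry, so the number of blocks grows along with the
   excess. *)
- move: us => /=; set x := head 0 st.
  have xp : x <= p by rewrite /x; case: (st) stp => //= ? ? /andP[].
  have -> : flatten (rev P) ++ x :: pops (behead st) p t =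
            flatten (rev ([:: x] :: P)) ++ pops (behead st) p t.
    by rewrite rev_cons flatten_rcons -catA.
  apply: IH => //=; first by rewrite szP.
  + move=> w; rewrite inE => /predU1P[->|]; last exact: sP.
    by apply: (@sortable_rcons [::] [::] x) => //; exists [::].
  + by rewrite xp.
  by case: (st) stp => //= ? ? /andP[].
- case: P szP sP Pp us => [|b [|a P]] // szP sP Pp us.
  have [E sP' Pp'] := merge p.+1 (pops st p.+1 t) a b P p (ltnSn p) sP Pp us.
  move: us => /=; rewrite E; apply: IH => //; first by move: szP => /= [->].
  exact: le_trans stp.
case: P szP sP Pp us => [|b [|a P]] // szP sP Pp us.
have [E sP' Pp'] := merge p.+2 _ a b P p (ltnW (ltnSn p.+1)) sP Pp us.
move: us => /=; rewrite E; apply: IH => //; first by move: szP => /= [->].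
by rewrite /= leqnSn; apply: le_trans stp; lia.
Qed.

(** * Reading a permutation as a pop sequence *)

Lemma subseq_pair (T : eqType) (a b : T) s :
  a \in s -> b \in s -> a != b -> subseq [:: a; b] s \/ subseq [:: b; a] s.
Proof.
elim: s => // x s IH; rewrite !inE.
have [->|ax] := eqVneq a x.
  by move=> _ /predU1P[->|bs]; rewrite ?eqxx // => _; left; rewrite /= eqxx sub1seq.
have [->|bx] := eqVneq b x.
  by move=> /= aS _ _; right; rewrite /= eqxx sub1seq.
by move=> /= aS bS ab; case: (IH aS bS ab) => ss; [left | right];
   apply: subseq_trans ss (subseq_cons _ _).
Qed.

Lemma subseq_cons_notin (T : eqType) (x : T) u s :
  x \notin u -> subseq u (x :: s) -> subseq u s.
Proof.
case: u => [|y u]; first by rewrite !sub0seq.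
by rewrite inE negb_or /= => /andP[xy _]; rewrite eq_sym (negbTE xy).
Qed.

Lemma subseq_cons_before (T : eqType) (a : T) st s :
  a \in s -> a \notin st -> subseq st s ->
  (forall z, z \in st -> ~~ subseq [:: z; a] s) -> subseq (a :: st) s.
Proof.
elim: s => // y s IH; rewrite inE.
have [<-|ay] /= := eqVneq a y; first by move=> _ ast /(subseq_cons_notin ast); rewrite eqxx.
rewrite (negbTE ay) => aS ast sts before; apply: IH => //; last first.
  by move=> z /before; apply: contra => zs; apply: subseq_trans zs (subseq_cons _ _).
case: st ast sts before => [|z st] ast sts before; first exact: sub0seq.
have := before z (mem_head _ _); move: sts; rewrite /=.
by have [->|] := eqVneq z y; rewrite ?sub1seq ?aS.
Qed.

(** The next entry [y] dictates the letter. If it is in the stack, it is the top, since the stack is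
    a subsequence of what remains. Otherwise the entries strictly between [p] and [y] are skipped;
    two skipped entries would form with [y] a 312 or a 321 above [m], so [y] is [p.+1] or [p.+2]. *)
Lemma pops_parse m s (h : bool) e st p x k :
  perm_eq s (st ++ iota p.+1 k) -> uniq s -> subseq st s ->
  sorted gtn (x :: st) -> x <= p -> m <= p ->
  all (fun y => y < m) (drop h st) -> (h -> m < head 0 st) ->
  avoids312 s -> avoids321_above m s ->
  balanced_from e (pairmap (fun a b => b < a) x s) ->
  exists t, [/\ s = pops st p t, run (h, e) t = Some (false, 0) &
    size st = small_pops h t + h].
Proof.
elim: s h e st p x k => [|y s IH] h e st p x k.
  move=> _ _; rewrite subseq0 => /eqP-> _ _ _ _.
  by case: h => [/(_ isT)//|_ _ _ /eqP->]; exists [::].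
move=> ps us sts xst xp mp sm hh a312 a321 bal.
have /andP[ys us'] : (y \notin s) && uniq s := us.
have a312' : avoids312 s.
  by move=> a b c ab bc ss; apply: (a312 a b c) => //; apply: subseq_trans ss (subseq_cons _ _).
have a321' : avoids321_above m s.
  by move=> b c d mb bc cd ss; apply: (a321 b c d) => //;
    apply: subseq_trans ss (subseq_cons _ _).
have [yst|yst] := boolP (y \in st).
  case: st ps sts xst sm hh yst => // z st ps sts xst sm hh yst.
  case: (subseq_cons2 sts) => [/mem_subseq/(_ _ yst)|[zy sts']]; first by rewrite (negbTE ys).
  subst z; clear yst sts; move: ps; rewrite /= perm_cons => ps.
  move: xst => /= /andP[yx yst]; rewrite /= yx in bal.
  have [|||t [-> rt sz]] := IH false e.+1 st p y k ps us' sts' yst _ mp _ _ a312' a321' bal => //.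
  - by move/leq_trans: (ltnW yx); apply.
  - by rewrite drop0; case: (h) sm => /=; rewrite ?drop0 // => /andP[].
  exists (0 :: t); split=> //=; case: h hh sm {bal} => hh sm; rewrite /= sz; lia.
have memE z : (z \in y :: s) = (z \in st) || (p < z <= p + k).
  by rewrite (perm_mem ps) mem_cat mem_iota; congr orb; lia.
have yp : p < y <= p + k by have := memE y; rewrite mem_head (negbTE yst) /= => <-.
have /andP[py _] := yp.
have xy : x < y := leq_ltn_trans xp py.
have sts' : subseq st s := subseq_cons_notin yst sts.
move: bal; rewrite /= ltnNge (ltnW xy) /=; case: e => // e bal.
have stp z : z \in st -> z <= p.
  have /allP xst' := order_path_min (rev_trans ltn_trans) xst.
  by move=> /xst' zx; apply: leq_trans (ltnW zx) xp.
have xst' q : p <= q -> sorted gtn (q.+1 :: st).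
  move=> pq; case: (st) xst stp => //= z st' /andP[_ ->] stp'; rewrite andbT ltnS.
  by apply: leq_trans pq; apply: stp'; rewrite mem_head.
have y312 a b : a < b -> b < y -> subseq [:: a; b] s -> False.
  by move=> ab bY ss; apply: (a312 a b y); rewrite //= eqxx.
have y321 b c : m < b -> b < c -> c < y -> subseq [:: c; b] s -> False.
  by move=> mb bc cy ss; apply: (a321 b c y); rewrite //= eqxx.
have [yE|yp1] := eqVneq y p.+1.
  case: k ps memE yp => [|k] ps memE yp; first by move: yp; clear; lia.
  have ps' : perm_eq s (st ++ iota p.+2 k).
    by apply/seq.permP => a; move/seq.permP/(_ a): ps; rewrite yE !count_cat /=; clear; lia.
  have yst' : sorted gtn (y :: st) by rewrite yE; apply: xst'.
  have yp' : y <= p.+1 by rewrite yE.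
  have [t [-> rt sz]] := IH h e st p.+1 y k ps' us' sts' yst' yp' (leqW mp) sm hh a312' a321' bal.
  by exists (1 :: t); split=> //=; rewrite yE.
have p1y : p.+1 < y by rewrite ltn_neqAle eq_sym yp1.
have p1s : p.+1 \in s.
  have := memE p.+1; rewrite inE eq_sym (negbTE yp1) /= => ->.
  by apply/orP; right; move: yp; clear; lia.
(* Now [p.+1] is skipped. A large entry already in the stack would form with [y] and [p.+1] a 312 or
   a 321 above [m]. *)
have hF : h = false.
  apply/negP => hT; have mb := hh hT; move: stp sts'.
  case: (st) mb => // b st' /= mb stp' sts'.
  have bp := stp' b (mem_head _ _); rewrite -ltnS in bp.
  have bs : b \in s by apply: (mem_subseq sts'); rewrite mem_head.
  case: (subseq_pair bs p1s (negbT (ltn_eqF bp))); first exact: y312.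
  exact: y321.
have yE : y = p.+2.
  apply/eqP/negPn/negP => yp2.
  have p2y : p.+2 < y by rewrite ltn_neqAle eq_sym yp2.
  have p2s : p.+2 \in s.
    have := memE p.+2; rewrite inE eq_sym (negbTE yp2) /= => ->.
    by apply/orP; right; move: yp p2y; clear; lia.
  have pp : p.+1 != p.+2 by rewrite ltn_eqF.
  by case: (subseq_pair p1s p2s pp); [apply: y312 | apply: y321].
have p1st : p.+1 \notin st by apply/negP => /stp; rewrite ltnn.
(* The skipped entry goes on top of the stack: a stack entry coming out before it would give a 312
   starting at [y]. *)
have sts2 : subseq (p.+1 :: st) s.
  apply: subseq_cons_before => // z zst; apply/negP.
  by apply: y312 => //; rewrite ltnS stp.
rewrite {}hF drop0 in sm hh bal *.
case: k ps memE yp => [|[|k]] ps memE yp; try by move: yp; rewrite yE; clear; lia.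
have ps' : perm_eq s ((p.+1 :: st) ++ iota p.+3 k).
  by apply/seq.permP => a; move/seq.permP/(_ a): ps; rewrite yE /= !count_cat /=; clear; lia.
have yst2 : sorted gtn (y :: p.+1 :: st) by rewrite yE /= ltnSn; apply: xst'.
have sm' : all (fun y => y < m) (drop true (p.+1 :: st)) by rewrite /= drop0.
have yp2 : y <= p.+2 by rewrite yE.
have [t [-> rt sz]] := IH true e (p.+1 :: st) p.+2 y k ps' us' sts2 yst2 yp2
  (leqW (leqW mp)) sm' (fun=> mp) a312' a321' bal.
by exists (2 :: t); split=> //=; [rewrite yE | move: sz => /=; clear; lia].
Qed.

(** * Pattern containment and one-line notation *)

Lemma contains_patternP w v :
  reflect (exists2 u, subseq u w & same_relative_order u v) (contains_pattern w v).
Proof.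
apply: (iffP existsP) => [[b sb]|[u /subseqP[b sz ->] sb]].
  by exists (mask b w) => //; apply: mask_subseq.
by exists (tcast sz (in_tuple b)); rewrite val_tcast.
Qed.

Lemma same_relative_orderP u v :
  reflect (size u = size v /\ forall i j, i < size u -> j < size u ->
    (nth 0 u i < nth 0 u j) = (nth 0 v i < nth 0 v j))
  (same_relative_order u v).
Proof.
apply: (iffP andP) => [[/eqP sz /forallP H]|[/eqP sz H]]; split=> //.
  by move=> i j iu ju; have /forallP/(_ (Ordinal ju))/eqP := H (Ordinal iu).
by apply/forallP => i; apply/forallP => j; apply/eqP; apply: H.
Qed.

Lemma contains312P w :
  reflect (exists a b c, [/\ a < b, b < c & subseq [:: c; a; b] w])
    (contains_pattern w [:: 3; 1; 2]).
Proof.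
apply: (iffP (contains_patternP w _)).
  case=> u ss /same_relative_orderP[sz H].
  case: u sz ss H => [|c [|a [|b [|]]]] //= _ ss H.
  by exists a, b, c; split; rewrite // (H 1 2, H 2 0).
move=> [a [b [c [ab bc ss]]]]; exists [:: c; a; b] => //.
by apply/same_relative_orderP; split=> // -[|[|[|i]]] [|[|[|j]]] //= _ _; lia.
Qed.

Lemma contains1432P w :
  reflect (exists a b c d, [/\ a < b, b < c, c < d & subseq [:: a; d; c; b] w])
    (contains_pattern w [:: 1; 4; 3; 2]).
Proof.
apply: (iffP (contains_patternP w _)).
  case=> u ss /same_relative_orderP[sz H].
  case: u sz ss H => [|a [|d [|c [|b [|]]]]] //= _ ss H.
  by exists a, b, c, d; split; rewrite // (H 0 3, H 3 2, H 2 1).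
move=> [a [b [c [d [ab bc cd ss]]]]]; exists [:: a; d; c; b] => //.
by apply/same_relative_orderP; split=> // -[|[|[|[|i]]]] [|[|[|[|j]]]] //= _ _; lia.
Qed.

Lemma one_line_perm n (p : 'S_n) : perm_eq (one_line p) (iota 1 n).
Proof.
apply: uniq_perm; rewrite ?iota_uniq //.
  by rewrite map_inj_uniq ?enum_uniq // => i j [/val_inj/perm_inj].
move=> x; rewrite mem_iota; apply/mapP/idP => [[i _ ->]|xn].
  exact: (ltn_ord (p i)).
have xn' : x.-1 < n by lia.
exists ((p^-1)%g (Ordinal xn')); rewrite ?mem_enum // permKV /=; lia.
Qed.

Lemma one_line_inj n : injective (@one_line n).
Proof.
move=> p q /eq_in_map E; apply/permP => i.
by have [] := E i (mem_enum _ _) => /val_inj.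
Qed.

Lemma one_line_surj n w : perm_eq w (iota 1 n) -> exists p : 'S_n, one_line p = w.
Proof.
move=> pw; have sw : size w = n by rewrite (perm_size pw) size_iota.
have uw : uniq w by rewrite (perm_uniq pw) iota_uniq.
have wE i : i < n -> 0 < nth 0 w i <= n.
  by move=> iN; have : nth 0 w i \in w;
    [rewrite mem_nth ?sw | rewrite (perm_mem pw) mem_iota; lia].
have fP (i : 'I_n) : (nth 0 w i).-1 < n by have := wE i (ltn_ord i); lia.
pose f i := Ordinal (fP i).
have fI : injective f.
  move=> i j [E]; apply/val_inj/eqP; rewrite -(nth_uniq 0 _ _ uw) ?sw; [|exact: ltn_ord..].
  by have := wE i (ltn_ord i); have := wE j (ltn_ord j); move: E => /=; lia.
exists (perm fI); apply: (@eq_from_nth _ 0); rewrite size_map size_enum_ord ?sw // => i iN.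
rewrite (nth_map (Ordinal iN)) ?size_enum_ord // permE /= nth_enum_ord //.
by rewrite prednK //; have := wE i iN; lia.
Qed.

(** A preimage among all words of distinct numbers has the entries of [one_line p], hence is itself
    a one-line notation, so both notions of uniqueness agree. *)
Lemma uniquely_sortedP n (p : 'S_n) :
  reflect (exists2 q, preimage (one_line p) q &
             forall q', preimage (one_line p) q' -> q' = q)
    (uniquely_sorted p).
Proof.
have uo (q : 'S_n) : uniq (one_line q).
  by rewrite (perm_uniq (one_line_perm q)) iota_uniq.
have ex q : preimage (one_line p) q -> exists q' : 'S_n, one_line q' = q.
  move=> pq; apply: one_line_surj; apply: perm_trans (one_line_perm p).
  by rewrite perm_sym preimage_perm.
apply: (iffP cards1P) => [[q qE]|[q pq uq]].
  have inE' r : preimage (one_line p) (one_line r) = (r == q).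
    by rewrite /preimage uo -in_set1 -qE inE.
  exists (one_line q); first by rewrite inE'.
  by move=> q' pq'; have [r rE] := ex _ pq'; move: pq'; rewrite -rE inE' => /eqP->.
have [r rE] := ex _ pq; exists r; apply/setP => x; rewrite !inE.
apply/eqP/eqP => [xp|->]; last by move: pq; rewrite -rE => /andP[_ /eqP].
by apply: one_line_inj; rewrite rE; apply: uq; rewrite /preimage uo xp eqxx.
Qed.

(** * Enumeration *)

(* Number of words with [x] letters E and [y] letters A each of whose prefixes
   contains at least twice as many letters E as letters A. *)
Fixpoint ballot (x : nat) : nat -> nat :=
  if x is x'.+1 then
    fix ballot_x (y : nat) : nat :=
      if y is y'.+1 then
        if 2 * y'.+1 <= x'.+1 then ballot x' y'.+1 + ballot_x y' else 0
      else 1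
  else fun y => nat_of_bool (y == 0).

Lemma ballotSS x y :
  ballot x.+1 y.+1 = if 2 * y.+1 <= x.+1 then ballot x y.+1 + ballot x.+1 y else 0.
Proof. by []. Qed.

Lemma ballot0 x : ballot x 0 = 1.
Proof. by case: x. Qed.

Lemma ballot_out x y : x < 2 * y -> ballot x y = 0.
Proof. by case: x y => [|x] [|y] // xy; rewrite ballotSS ifN // -ltnNge. Qed.

(** The ballot theorem for slope 2, with the denominator cleared. The range includes [2 * y = x.+1],
    where both sides vanish; the induction needs this boundary case. *)
Lemma ballot_closed x y :
  2 * y <= x.+1 -> x.+1 * ballot x y = (x.+1 - 2 * y) * 'C(x + y, y).
Proof.
elim: x y => [|x IHx]; first by case=> [|y] //= h; lia.
elim=> [|y IHy] h; first by rewrite ballot0 muln0 subn0 bin0.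
rewrite ballotSS; case: ifP => h2; last by rewrite (_ : _ - _ = 0) ?muln0 //; lia.
(* Over the rationals, both recursive terms and both terms of Pascal's rule become multiples of
   ['C(x + y.+1, y)]. *)
have /(congr1 (fun n => n%:R%R : rat)) P := IHx y.+1 h2.
have /(congr1 (fun n => n%:R%R : rat)) Q := IHy ltac:(lia).
have /(congr1 (fun n => n%:R%R : rat)) S := mul_bin_left (x + y.+1) y.
have -> : x.+1 + y.+1 = (x + y.+1).+1 by [].
rewrite binS; move: P Q S; rewrite (_ : x.+1 + y = x + y.+1) ?addnS //.
rewrite (_ : (x + y).+1 - y = x.+1); last by lia.
set b := 'C(_, _); set c := 'C(_, _); set p := ballot _ _; set q := ballot _ _.
move=> P Q S; clearbody b c p q.
move: P Q S; rewrite !natrM !natrB ?natrM; [|lia..] => P Q S.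
apply/eqP; rewrite -(eqr_nat rat) !natrM !natrD natrB; last by lia.
move: P Q S; rewrite !natrM -!natr1 => P Q S.
have x0 : (0 <= x%:R :> rat)%R by apply: ler0n.
have y0 : (0 <= y%:R :> rat)%R by apply: ler0n.
have x1 : (x%:R + 1 != 0 :> rat)%R by apply: lt0r_neq0; lra.
have y1 : (y%:R + 1 != 0 :> rat)%R by apply: lt0r_neq0; lra.
have x2 : (x%:R + 1 + 1 != 0 :> rat)%R by apply: lt0r_neq0; lra.
have {}S : (b%:R = (x%:R + 1) * c%:R / (y%:R + 1) :> rat)%R.
  by apply: (mulfI y1); rewrite S; field.
rewrite {}S in P *.
have {}P : (p%:R = (x%:R + 1 - (0 + 1 + 1) * (y%:R + 1)) * c%:R / (y%:R + 1) :> rat)%R.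
  by apply: (mulfI x1); rewrite P; field.
have {}Q : (q%:R = (x%:R + 1 + 1 - (0 + 1 + 1) * y%:R) * c%:R / (x%:R + 1 + 1) :> rat)%R.
  by apply: (mulfI x2); rewrite Q; field.
by rewrite P Q; apply/eqP; field; rewrite x2 y1.
Qed.

(** Words grow at the end because [reachingS] splits off the last letter. *)
Fixpoint words (n : nat) : seq (seq nat) :=
  if n is n'.+1 then [seq rcons t c | c <- [:: 0; 1; 2], t <- words n'] else [:: [::]].

Lemma words_uniq n : uniq (words n).
Proof.
elim: n => //= n IH; apply: (@allpairs_uniq _ _ _ (fun c t => rcons t c) [:: 0; 1;
  2] (words n)) => //.
by move=> [c t] [c' t'] _ _ /= /rcons_inj[-> ->].
Qed.

Lemma mem_words n t : (t \in words n) = (size t == n) && all (fun c => c <= 2) t.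
Proof.
elim: n t => [|n IH] t; first by case: t.
apply/allpairsP/andP => [[[c u] /= [cin uin ->]]|[]].
  move: uin; rewrite IH size_rcons eqSS all_rcons => /andP[-> ->]; split=> //; rewrite andbT.
  by move: cin; rewrite !inE => /or3P[] /eqP->.
case/lastP: t => // u c; rewrite size_rcons eqSS all_rcons => sz /andP[c2 u2].
exists (c, u); split=> //=; last by rewrite IH sz u2.
by case: c c2 => [|[|[|]]].
Qed.

Lemma run_rcons he t c : run he (rcons t c) = obind (step c) (run he t).
Proof. by elim: t he => /= [he|a t IH he]; case: (step _ he). Qed.

Lemma run_excess h e t h' e' : run (h, e) t = Some (h', e') -> e' <= e + size t.
Proof.
elim: t h e => [|[|[|[|c]]] t IH] h e //=.
- by case=> _ ->; lia.
- by move/IH; lia.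
- by case: e => //= e /IH; lia.
- by case: e h => //= e [] //= /IH; lia.
Qed.

Definition reaching (h : bool) (e n : nat) : nat :=
  count (fun t => run (false, 0) t == Some (h, e)) (words n).

Lemma reaching_out h e n : n < e -> reaching h e n = 0.
Proof.
move=> ne; apply/eqP; rewrite -leqn0 leqNgt -has_count; apply/hasPn => t.
rewrite mem_words => /andP[/eqP sz _]; apply/eqP => /run_excess; rewrite sz; lia.
Qed.

(** Letter 1 keeps the flag and lowers the excess, letter 2 lowers it while turning the flag from
    false to true, and letter 0 raises it and resets the flag from either value. *)
Lemma reachingS h e n :
  reaching h e n.+1 =
  if h then reaching true e.+1 n + reaching false e.+1 n
  else reaching false e.+1 n +
    if e is e'.+1 then reaching false e' n + reaching true e' n else 0.
Proof.
have E1 a b c d : (Some (a, b) == Some (c, d) :> option (bool * nat)) =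
  (a == c) && (b == d) by [].
have E2 a : (None == Some a :> option (bool * nat)) = false by [].
rewrite /reaching /= cats0 !count_cat !count_map; elim: (words n) => [|t l].
  by case: h; case: e.
rewrite /= !run_rcons.
case: (run _ t) => [[[] [|f]]|] /=; case: h; case: e => [|e] /=;
  rewrite ?E1 ?E2 /=; lia.
Qed.

(* A ballot word alternates D's and marks: its letters E are, after a dummy
   first one, alternately descents and marks, the mark telling where, inside a
   run of ascents, the stack starts to retain a large entry. *)
Lemma reaching_ballot n d a :
  n = d + a -> a <= d ->
  reaching false (d - a) n = ballot (2 * d) a /\
  reaching true (d - a) n = if a is a'.+1 then ballot (2 * d).+1 a' else 0.
Proof.
elim: n d a => [|n IH] d a nE ad.
  by case: d a nE ad => [|d] [|a].
rewrite !reachingS; split; last first.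
  case: a nE ad => [|a] nE ad; first by rewrite !reaching_out //; lia.
  have [||I0 I1] := IH d a; [lia..|].
  rewrite subnSK // I0 I1; case: a {nE I0 I1 IH} ad => [|a] ad; first by rewrite !ballot0.
  by rewrite ballotSS ifT; lia.
case: d nE ad => [|d] nE ad; first by lia.
have -> : 2 * d.+1 = (2 * d).+2 by lia.
case: a nE ad => [|a] nE ad.
  rewrite subn0 ballot0 reaching_out; last by lia.
  have [||I0 I1] := IH d 0; [lia..|].
  by rewrite subn0 in I0 I1; rewrite I0 I1 ballot0.
have [||I0 _] := IH d.+1 a; [lia..|].
rewrite (_ : (d.+1 - a.+1).+1 = d.+1 - a) ?I0; last by lia.
rewrite (_ : 2 * d.+1 = (2 * d).+2); last by lia.
rewrite (ballotSS (2 * d).+1 a) ifT; last by lia.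
(* At excess 0 the last letter cannot be a descent, and the matching ballot number is out of range,
   hence zero. *)
have [eq_ad|ne_ad] := eqVneq a d.
  by rewrite (@ballot_out (2 * d).+1 a.+1) ?eq_ad ?subnn; [exact: addnC | lia].
have [||J0 J1] := IH d a.+1; [lia..|].
have -> : d.+1 - a.+1 = (d - a.+1).+1 by lia.
rewrite J0 J1 ballotSS ifT; lia.
Qed.

(** Before the first output [m], the entries 1 to [m] are pushed. The [m.-1] entries left behind are
    those removed by the small pops, so [t] determines [m]. *)
Definition code_word (t : seq nat) : seq nat :=
  let m := (small_pops false t).+1 in m :: pops (rev (iota 1 m.-1)) m t.

Lemma sorted_rev_iota n p : n < p -> sorted gtn (p :: rev (iota 1 n)).
Proof.
move=> np; have -> : p :: rev (iota 1 n) = rev (rcons (iota 1 n) p) by rewrite rev_rcons.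
rewrite rev_sorted; apply: (@path_sorted _ ltn 0).
move: np; rewrite -{1}[n]add0n; elim: n 0 => [|n IH] m /=; first by rewrite addn0 andbT.
by rewrite ltnSn addnS -addSn; apply: IH.
Qed.

Lemma code_word_inj t t' :
  run (false, 0) t = Some (false, 0) -> run (false, 0) t' = Some (false, 0) ->
  code_word t = code_word t' -> t = t'.
Proof.
move=> rt rt' [<-]; apply: pops_inj; try exact: run_letters; first exact: run_letters rt.
  exact: run_letters rt'.
by apply/allP => x; rewrite mem_rev mem_iota; lia.
Qed.

Lemma iota_split m n : m <= n -> 0 < m ->
  iota 1 n = iota 1 m.-1 ++ m :: iota m.+1 (n - m).
Proof.
move=> mn m0; have {1}-> : n = m.-1 + (n - m).+1 by lia.
by rewrite iotaD /= add1n prednK.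
Qed.

Lemma code_word_perm t :
  run (false, 0) t = Some (false, 0) -> perm_eq (code_word t) (iota 1 (size t).+1).
Proof.
move=> rt; rewrite /code_word; set m := small_pops false t.
have pt : perm_eq (pops (rev (iota 1 m)) m.+1 t) (rev (iota 1 m) ++ iota m.+2 (sumn t)).
  by apply: perm_pops rt _; rewrite size_rev size_iota addn0.
have pm : perm_eq (m.+1 :: pops (rev (iota 1 m)) m.+1 t) (iota 1 (m.+1 + sumn t)).
  rewrite (@iota_split m.+1 (m.+1 + sumn t)) ?leq_addr // addKn /=.
  apply/seq.permP => a; move/seq.permP/(_ a): pt; rewrite /= !count_cat count_rev /=; lia.
(* Each letter produces exactly one output, so comparing lengths identifies the largest entry with
   [(size t).+1]. *)
have := perm_size pm; rewrite size_iota => sz.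
suff -> : (size t).+1 = m.+1 + sumn t by [].
rewrite -sz /=; congr _.+1; elim: (t) (rev _) m.+1 => [|[|[|c]] u IH] st p //=; by rewrite -IH.
Qed.

Lemma avoids312_desc s x y w :
  avoids312 (w :: s) -> uniq (w :: s) -> x < w -> y < w -> subseq [:: x; y] s -> y < x.
Proof.
move=> a312 us xw yw ss; case: (ltngtP y x) => // xy.
  by case: (a312 x y w xy yw); rewrite /= eqxx.
move: us => /= /andP[_ us]; have := subseq_uniq ss us.
by rewrite /= inE xy eqxx.
Qed.

Lemma uniquely_sorted_code k (p : 'S_(2 * k + 1)) :
  p \in uniquely_sorted_avoiding (2 * k + 1) [:: [:: 3; 1; 2]; [:: 1; 4; 3; 2]] ->
  exists t, [/\ one_line p = code_word t, run (false, 0) t = Some (false, 0) & size t = 2 * k].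
Proof.
rewrite inE =>
  /andP[/uniquely_sortedP[q pq uq] /and3P[/contains312P a312 /contains1432P a1432 _]].
have bal := unique_preimage_balanced pq uq.
have pw := one_line_perm p.
have sw := perm_size pw; rewrite size_iota in sw.
move: (one_line p) => w in pq uq a312 a1432 bal pw sw *.
case: w => [|m s] in pq uq a312 a1432 bal pw sw *; first by rewrite addn1 in sw.
have us : uniq (m :: s) by rewrite (perm_uniq pw) iota_uniq.
have mE : 0 < m <= 2 * k + 1.
  by have := perm_mem pw m; rewrite mem_head mem_iota; lia.
have {}a312 : avoids312 (m :: s).
  by move=> a b c ab bc ss; apply: a312; exists a, b, c.
have a312' : avoids312 s.
  by move=> a b c ab bc ss; apply: (a312 a b c) => //; apply: subseq_trans ss (subseq_cons _ _).
have a321 : avoids321_above m s.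
  move=> b c d mb bc cd ss; apply: a1432; exists m, b, c, d; split=> //.
  by rewrite /= eqxx.
have ps : perm_eq s (rev (iota 1 m.-1) ++ iota m.+1 (2 * k + 1 - m)).
  apply/seq.permP => a; move/seq.permP/(_ a): pw; rewrite (@iota_split m (2 * k + 1)); [|lia..].
  rewrite /= !count_cat count_rev /=; lia.
(* Since 312 is avoided, the entries below [m] appear in decreasing order after [m]; this is the
   order of the stack once [m] is popped. *)
have stE : rev (iota 1 m.-1) = [seq x <- s | x < m].
  apply: (@sorted_eq _ gtn).
  - by move=> x y z /= xy yz; apply: ltn_trans yz xy.
  - by move=> x y /= /andP[/ltn_trans h /h]; rewrite ltnn.
  - by apply: path_sorted (@sorted_rev_iota m.-1 m _); lia.
  - rewrite sorted_pairwise; last by move=> x y z /= xy yz; apply: ltn_trans yz xy.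
    have : forall x y, x < m -> y < m -> subseq [:: x; y] s -> y < x.
      by move=> x y xm ym; apply: avoids312_desc a312 us xm ym.
    elim: (s) => //= x s' IH desc.
    have {}IH : pairwise gtn [seq y <- s' | y < m].
      by apply: IH => y z ym zm ss; apply: desc => //; apply: subseq_trans ss (subseq_cons _ _).
    case: ifP => //= xm; rewrite IH andbT; apply/allP => y; rewrite mem_filter => /andP[ym ys].
    by apply: desc; rewrite // eqxx sub1seq.
  apply: uniq_perm; rewrite ?rev_uniq ?iota_uniq ?filter_uniq //; first by case/andP: us.
  move=> x; rewrite mem_filter (perm_mem ps) mem_cat !mem_rev !mem_iota; lia.
have [|||||t [sE rt sz]] :=
    @pops_parse m s false 0 (rev (iota 1 m.-1)) m m (2 * k + 1 - m) ps _ _ _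
      (leqnn m) (leqnn m) _ _ a312' a321 bal => //.
- by case/andP: us.
- by rewrite stE filter_subseq.
- by apply: sorted_rev_iota; lia.
- by rewrite drop0; apply/allP => x; rewrite mem_rev mem_iota; lia.
have tE : small_pops false t = m.-1 by move: sz; rewrite size_rev size_iota addn0.
have wE : code_word t = m :: pops (rev (iota 1 m.-1)) m t.
  by rewrite /code_word tE prednK //; lia.
have {}wE : code_word t = m :: s by rewrite wE sE.
exists t; split=> //.
by have := perm_size (code_word_perm rt); rewrite wE sw size_iota; lia.
Qed.

Lemma code_uniquely_sorted k t :
  run (false, 0) t = Some (false, 0) -> size t = 2 * k ->
  exists2 p : 'S_(2 * k + 1), one_line p = code_word t &
    p \in uniquely_sorted_avoiding (2 * k + 1) [:: [:: 3; 1; 2]; [:: 1; 4; 3; 2]].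
Proof.
move=> rt sz.
have pt : perm_eq (code_word t) (iota 1 (2 * k + 1)).
  by rewrite addn1 -sz; apply: code_word_perm.
have [p pE] := one_line_surj pt; exists p => //.
have ut : uniq (code_word t) by rewrite (perm_uniq pt) iota_uniq.
move: pt ut pE; rewrite /code_word /=; set c := small_pops false t.
set m := c.+1; set st := rev (iota 1 c); set s := pops st m t => pt us pE.
have szst : size st = small_pops false t + false by rewrite size_rev size_iota addn0.
have mst : sorted gtn (m :: st) by apply: sorted_rev_iota.
have sst := path_sorted mst.
have stm : all (fun x => x < m) st by apply/allP => x; rewrite mem_rev mem_iota; lia.
have stm' : all (fun x => x <= m) st by apply: sub_all stm => x /ltnW.
have [a312 a321] : avoids312 s /\ avoids321_above m s.
  by apply: (pops_avoids rt szst) => //; rewrite drop0.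
have ss : subseq st s by apply: subseq_pops rt szst.
have [ms us'] : m \notin s /\ uniq s by case/andP: us.
have ins x : x \in s -> x < m -> x \in st.
  by rewrite (perm_mem (perm_pops m rt szst)) mem_cat mem_iota; case: (x \in st) => //=; lia.
have desc a b : a < m -> b < m -> subseq [:: a; b] s -> b < a.
  move=> am bm ab; have /allP abs : all (mem s) [:: a; b].
    by apply/allP => x xab; apply: (mem_subseq ab).
  by apply: (subseq_desc us' ss sst) => //; apply: ins => //; apply: abs; rewrite !inE eqxx ?orbT.
rewrite inE; apply/and4P; split=> //.
- have [q pq] : sortable (m :: s).
    have := @pops_sortable t false 0 st m [:: [:: m]] rt erefl; apply=> //=.
    + by move=> w; rewrite inE => /eqP->; apply: (@sortable_rcons [::] [::] m) => //; exists [::].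
    + by rewrite leqnn.
  apply/uniquely_sortedP; rewrite pE; exists q => // q' pq'.
  by apply: balanced_preimage_uniq pq' pq _; apply: descent_word_pops rt szst mst (leqnn m).
- rewrite /avoids pE; apply/contains312P => -[a [b [d [ab bd /subseq_cons2[|[dm sab]]]]]].
    exact: a312.
  have := desc a b; rewrite -dm; move/(_ (ltn_trans ab bd) bd sab); lia.
rewrite /avoids pE; apply/contains1432P => -[a [b [d [e [ab bd de]]]]].
case/subseq_cons2=> [saedb|[am sedb]]; last first.
  by apply: (a321 b d e) => //; rewrite -am.
have sedb : subseq [:: e; d; b] s by apply: subseq_trans saedb; apply: subseq_cons.
(* If [b] exceeds [m], the last three entries form a 321 above [m]. If [b] is below [m], then [a]
   and [b] are small entries appearing in increasing order. *)
case: (ltngtP m b) => mb; last 1 first.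
- by have := mem_subseq sedb; rewrite -mb => /(_ m); rewrite !inE eqxx !orbT (negbTE ms) =>
    /(_ isT).
- exact: (a321 b d e).
have sab : subseq [:: a; b] s.
  apply: subseq_trans saedb.
  by apply: (@cat_subseq _ [:: a] [:: b] [:: a] [:: e; d; b]); rewrite sub1seq !inE eqxx ?orbT.
have := desc a b (ltn_trans ab mb) mb sab; lia.
Qed.

Lemma card_uniquely_sorted_avoiding k :
  #|uniquely_sorted_avoiding (2 * k + 1) [:: [:: 3; 1; 2]; [:: 1; 4; 3; 2]]| = ballot (2 * k) k.
Proof.
(* An accepted word of length [2 * k] ends at excess 0, so it has [k] descents and [k] ascents. *)
have [||<- _] := @reaching_ballot (2 * k) k k; [lia..|].
rewrite subnn /reaching -size_filter cardE -(size_map (@one_line _)).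
rewrite -(size_map code_word (filter _ _)); apply: perm_size; apply: uniq_perm.
- by rewrite (map_inj_uniq (@one_line_inj _)) enum_uniq.
- rewrite map_inj_in_uniq ?filter_uniq ?words_uniq // => t t'.
  rewrite !mem_filter => /andP[/eqP rt _] /andP[/eqP rt' _].
  exact: code_word_inj rt rt'.
move=> w; apply/mapP/mapP => [[p]|[t]].
  rewrite mem_enum => /uniquely_sorted_code[t [-> rt sz]] ->; exists t => //.
  by rewrite mem_filter rt eqxx mem_words sz eqxx (run_letters rt).
rewrite mem_filter mem_words => /andP[/eqP rt /andP[/eqP sz _]] ->.
by have [p pE pU] := code_uniquely_sorted rt sz; exists p; rewrite ?mem_enum.
Qed.

Local Open Scope ring_scope.

Theorem theorem5p5 (k : nat) :
  #|uniquely_sorted_avoiding (2 * k + 1)%N [:: [:: 3; 1; 2]%N; [:: 1; 4; 3; 2]%N]|%:R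
  = (2 * k + 1)%:R^-1 * 'C(3 * k, k)%:R :> rat.
Proof.
rewrite card_uniquely_sorted_avoiding.
have := @ballot_closed (2 * k) k (leqnSn _).
(* For [x = 2 * k] and [y = k] the factor [x.+1 - 2 * y] equals 1. *)
rewrite subSnn mul1n -mulSnr addn1 => <-.
by rewrite natrM mulKf // pnatr_eq0.
Qed.
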